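(* For every positive integer $n$, the $1$-defective incidence chromatic number of the complete graph $K_n$ satisfies $\chi^1_i(K_n)=n-1$ if $n\neq 2,4$, and $\chi^1_i(K_n)=n$ if $n\in\{2,4\}$.
   Context: All graphs are simple. For a graph $G$, an incidence is a pair $(v,e)$ with $v\in V(G)$ an endpoint of the edge $e\in E(G)$; $I(G)$ is the set of all incidences. For $u\in V(G)$ and a neighbor $v$ of $u$, $(u,uv)$ is a strong incidence of $u$ and $(v,uv)$ is a weak incidence of $u$; $I_u$ and $A_u$ denote the sets of strong and weak incidences of $u$. For a map $\varphi$ on $I(G)$, $\varphi(I_u)=\{\varphi(u,uv): v\in N_G(u)\}$. Let $[k]=\{1,\dots,k\}$. A $d$-defective incidence $k$-coloring of $G$ is a map $\varphi: I(G)\to[k]$ such that for every $u\in V(G)$: (a) $\varphi(u,uv)\neq\varphi(u,uw)$ for distinct $v,w\in N_G(u)$; (b) $\varphi(u,uv)\neq\varphi(v,uv)$ for every $v\in N_G(u)$; (c) every color in $\varphi(I_u)$ appears at most $d$ times among the incidences of $A_u$. $\chi^d_i(G)$ is the minimum $k$ such that $G$ has a $d$-defective incidence $k$-coloring. *)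

(* Defs.v *)
From mathcomp Require Import all_boot.

Set Implicit Arguments.
Unset Strict Implicit.
Unset Printing Implicit Defensive.

Record sgraph := SGraph {
  vertex :> finType;
  adj : rel vertex;
  adj_sym : symmetric adj;
  adj_irr : irreflexive adj }.
Arguments adj {s}.

Definition edges (G : sgraph) : {set {set G}} :=
  [set E : {set G} | [exists x : G, [exists y : G, adj x y && (E == [set x; y])]]].

Definition is_incidence (G : sgraph) : pred (G * {set G}) :=
  fun i => (i.1 \in i.2) && (i.2 \in edges G).

Definition incidence (G : sgraph) := {i : G * {set G} | is_incidence i}.

Definition nbr (G : sgraph) (u : G) := {v : G | adj u v}.

Fact edge_nbr (G : sgraph) (u : G) (v : nbr u) : [set u; val v] \in edges G.
Proof.
rewrite inE; apply/existsP; exists u; apply/existsP; exists (val v).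
by rewrite (valP v) eqxx.
Qed.

Fact sinc_subproof (G : sgraph) (u : G) (v : nbr u) :
  is_incidence (u, [set u; val v]).
Proof. by rewrite /is_incidence edge_nbr /= set21. Qed.

Fact winc_subproof (G : sgraph) (u : G) (v : nbr u) :
  is_incidence (val v, [set u; val v]).
Proof. by rewrite /is_incidence edge_nbr /= set22. Qed.

(* The incidence (u, uv), for v a neighbor of u. *)
Definition sinc (G : sgraph) (u : G) (v : nbr u) : incidence G :=
  exist _ (u, [set u; val v]) (sinc_subproof v).

(* The incidence (v, uv), for v a neighbor of u. *)
Definition winc (G : sgraph) (u : G) (v : nbr u) : incidence G :=
  exist _ (val v, [set u; val v]) (winc_subproof v).

Definition strong_inc (G : sgraph) (u : G) : {set incidence G} :=
  [set sinc v | v : nbr u].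

Definition weak_inc (G : sgraph) (u : G) : {set incidence G} :=
  [set winc v | v : nbr u].

(* The k colors are the elements 0, ..., k - 1 of 'I_k. *)
Definition defective_incidence_coloring (G : sgraph) (d k : nat)
    (phi : {ffun incidence G -> 'I_k}) : bool :=
  [forall u : G,
    [&& [forall v : nbr u, forall w : nbr u,
           (v != w) ==> (phi (sinc v) != phi (sinc w))],
        [forall v : nbr u, phi (sinc v) != phi (winc v)]
      & [forall c in phi @: strong_inc u,
           #|[set i in weak_inc u | phi i == c]| <= d]]].

Definition defective_incidence_colorable (G : sgraph) (d k : nat) : bool :=
  [exists phi : {ffun incidence G -> 'I_k}, defective_incidence_coloring d phi].

Lemma sinc_neq_winc (G : sgraph) (u : G) (v w : nbr u) : sinc v != winc w.
Proof.
apply/eqP => /(congr1 val) /= [uw _].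
by have := valP w; rewrite /= -uw adj_irr.
Qed.

Lemma sinc_inj (G : sgraph) (u : G) : injective (@sinc G u).
Proof.
move=> v w /(congr1 val) [uvw]; apply: val_inj.
have: val v \in [set u; val w] by rewrite -uvw set22.
rewrite !inE => /orP[/eqP vu|/eqP //].
by have := valP v; rewrite vu adj_irr.
Qed.

(* Giving distinct colors to all incidences is a d-defective coloring for
   every d, so the minimum defining the chromatic number exists. *)
Lemma defective_incidence_colorable_ex (G : sgraph) (d : nat) :
  exists k, defective_incidence_colorable G d k.
Proof.
exists #|{: incidence G}|; apply/existsP; exists [ffun i => enum_rank i].
apply/forallP=> u; apply/and3P; split.
- apply/forallP=> v; apply/forallP=> w; apply/implyP; apply: contraNneq.
  by rewrite !ffunE => /enum_rank_inj/sinc_inj ->.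
- by apply/forallP=> v; rewrite !ffunE (inj_eq enum_rank_inj) sinc_neq_winc.
apply/forall_inP=> c /imsetP[i /imsetP[v _ ->] ->].
rewrite (_ : [set _ in _ | _] = set0) ?cards0 //.
apply/setP=> j; rewrite !inE; apply/negP=> /andP[/imsetP[w _ ->]].
by rewrite !ffunE (inj_eq enum_rank_inj) eq_sym (negPf (sinc_neq_winc _ _)).
Qed.

Definition defective_incidence_chromatic (G : sgraph) (d : nat) : nat :=
  ex_minn (defective_incidence_colorable_ex G d).

Fact complete_sym (n : nat) : symmetric (fun x y : 'I_n => x != y).
Proof. by move=> x y; rewrite eq_sym. Qed.

Fact complete_irr (n : nat) : irreflexive (fun x y : 'I_n => x != y).
Proof. by move=> x; rewrite eqxx. Qed.

Definition complete_graph (n : nat) : sgraph :=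
  SGraph (@complete_sym n) (@complete_irr n).

(* Main.v *)
Require Import Defs.
From mathcomp Require Import all_boot zify.

Set Implicit Arguments.
Unset Strict Implicit.
Unset Printing Implicit Defensive.

(** A coloring of the incidences of [K_n] is an [n * n] array with empty
    diagonal, the color of [(u, uv)] being the entry [M u v].  With [n - 1]
    colors every row contains all colors, so that the colorings are the Latin
    arrays such that [M u v <> M v u].  For odd [n] the array [v - u mod n]
    works.  An array of order [n >= 2] yields one of order [2n]: put two copies
    of it in the diagonal blocks, and in the two other blocks [n] new colors
    arranged as the Cayley tables [u + v] and [u + v + 1].  Hence every [n] other
    than [2] and [4] is reached from an odd number or from an array of order
    [8].  The lower bound [n - 1] is the degree, the color [v] for the incidence
    [(u, uv)] gives the upper bound [n], and [K_4] has no coloring with 3 colors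
    by exhaustion. *)

(** * Latin arrays with [n.-1] colors *)

Definition skew_latin n (M : nat -> nat -> nat) :=
  [/\ forall u v, u < n -> v < n -> u != v -> M u v < n.-1,
      forall u v w, u < n -> v < n -> w < n -> u != v -> u != w ->
        M u v = M u w -> v = w,
      forall u v w, u < n -> v < n -> w < n -> u != v -> u != w ->
        M v u = M w u -> v = w
    & forall u v, u < n -> v < n -> u != v -> M u v != M v u].

(** The entry is the residue of [v - u] modulo [n], lowered by one since the residue 0 occurs only
    on the diagonal. Equal entries at transposed positions would give [2 (v - u) = 0] modulo [n],
    which oddness excludes. *)
Lemma skew_latin_odd n : odd n ->
  skew_latin n (fun u v => if u < v then v - u - 1 else n + v - u - 1).
Proof.
move=> n_odd; split.
- by move=> u v *; case: (ltnP u v); lia.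
- by move=> u v w ? ? ? ? ?; case: (ltnP u v); case: (ltnP u w); lia.
- by move=> u v w ? ? ? ? ?; case: (ltnP v u); case: (ltnP w u); lia.
- by move=> u v *; case: (ltnP u v); case: (ltnP v u); lia.
Qed.

(** Reduction modulo [n] for [s < 2n], in a form that [lia] handles after a case split. *)
Definition wrap n s := if s < n then s else s - n.

Definition double_array n (M : nat -> nat -> nat) u v :=
  match u < n, v < n with
  | true, true => M u v
  | false, false => M (u - n) (v - n)
  | true, false => n.-1 + wrap n (u + (v - n))
  | false, true => n.-1 + wrap n ((u - n) + v + 1)
  end.

(** The new colors start at [n.-1], just above those of [M], so diagonal and off-diagonal blocks
    never clash. Transposed entries of the off-diagonal blocks differ by 1 modulo [n], hence are
    distinct as [1 < n]. *)
Lemma skew_latin_double n M :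
  1 < n -> skew_latin n M -> skew_latin n.*2 (double_array n M).
Proof.
move=> n_gt1 [ltM rowM colM skewM]; rewrite /double_array /wrap; split.
- move=> u v ltu ltv neq_uv; case: (ltnP u n) => hu; case: (ltnP v n) => hv.
  + by have := ltM u v hu hv neq_uv; lia.
  + by case: ifP; lia.
  + by case: ifP; lia.
  + by have := ltM (u - n) (v - n); lia.
- move=> u v w ltu ltv ltw neq_uv neq_uw.
  case: (ltnP u n) => hu; case: (ltnP v n) => hv; case: (ltnP w n) => hw.
  + by apply: rowM.
  + by have := ltM u v hu hv neq_uv; lia.
  + by have := ltM u w hu hw neq_uw; lia.
  + by do 2!case: ifP; lia.
  + by do 2!case: ifP; lia.
  + by have := ltM (u - n) (w - n); lia.
  + by have := ltM (u - n) (v - n); lia.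
  + by have := rowM (u - n) (v - n) (w - n); lia.
- move=> u v w ltu ltv ltw neq_uv neq_uw.
  case: (ltnP u n) => hu; case: (ltnP v n) => hv; case: (ltnP w n) => hw.
  + by apply: colM.
  + by have := ltM v u hv hu; lia.
  + by have := ltM w u hw hu; lia.
  + by do 2!case: ifP; lia.
  + by do 2!case: ifP; lia.
  + by have := ltM (w - n) (u - n); lia.
  + by have := ltM (v - n) (u - n); lia.
  + by have := colM (u - n) (v - n) (w - n); lia.
- move=> u v ltu ltv neq_uv; case: (ltnP u n) => hu; case: (ltnP v n) => hv.
  + exact: skewM.
  + by do 2!case: ifP; lia.
  + by do 2!case: ifP; lia.
  + by apply: skewM; lia.
Qed.

(* Found by computer search; the diagonal entries are irrelevant. *)
Definition table8 :=
  [:: [:: 7; 0; 1; 2; 3; 4; 5; 6];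
      [:: 1; 7; 6; 0; 2; 3; 4; 5];
      [:: 4; 1; 7; 3; 6; 5; 0; 2];
      [:: 0; 5; 2; 7; 4; 1; 6; 3];
      [:: 2; 6; 3; 5; 7; 0; 1; 4];
      [:: 5; 2; 4; 6; 1; 7; 3; 0];
      [:: 6; 3; 5; 4; 0; 2; 7; 1];
      [:: 3; 4; 0; 1; 5; 6; 2; 7]].

Lemma all_iotaP n (P : pred nat) :
  reflect (forall i, i < n -> P i) (all P (iota 0 n)).
Proof.
apply: (iffP allP) => P_n i; first by move=> ltin; rewrite P_n ?mem_iota.
by rewrite mem_iota; apply: P_n.
Qed.

Lemma skew_latin_8 : skew_latin 8 (fun u v => nth 0 (nth [::] table8 u) v).
Proof.
set M := fun u v : nat => _.
have row_col : all (fun u => all (fun v => all (fun w =>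
    [|| u == v, u == w, v == w | (M u v != M u w) && (M v u != M w u)])
  (iota 0 8)) (iota 0 8)) (iota 0 8) by vm_compute.
have bound_skew : all (fun u => all (fun v =>
    (u == v) || (M u v < 7) && (M u v != M v u))
  (iota 0 8)) (iota 0 8) by vm_compute.
split.
- move=> u v ltu ltv /negPf neq_uv.
  move/all_iotaP: bound_skew => /(_ u ltu)/all_iotaP/(_ v ltv).
  by rewrite neq_uv => /andP[].
- move=> u v w ltu ltv ltw /negPf neq_uv /negPf neq_uw eqM.
  move/all_iotaP: row_col => /(_ u ltu)/all_iotaP/(_ v ltv)/all_iotaP/(_ w ltw).
  by rewrite neq_uv neq_uw eqM eqxx orbF => /eqP.
- move=> u v w ltu ltv ltw /negPf neq_uv /negPf neq_uw eqM.
  move/all_iotaP: row_col => /(_ u ltu)/all_iotaP/(_ v ltv)/all_iotaP/(_ w ltw).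
  by rewrite neq_uv neq_uw eqM eqxx andbF orbF => /eqP.
- move=> u v ltu ltv /negPf neq_uv.
  move/all_iotaP: bound_skew => /(_ u ltu)/all_iotaP/(_ v ltv).
  by rewrite neq_uv => /andP[].
Qed.

Lemma skew_latin_exists n : 2 < n -> n != 4 -> exists M, skew_latin n M.
Proof.
elim/ltn_ind: n => n IHn n_gt2 n_neq4.
have [n_odd|n_even] := boolP (odd n); first by eexists; apply: skew_latin_odd.
(* Halving 8 would lead to the excluded order 4; any other even order left is at least 6, and its
   half is neither 4 nor below 3. *)
have [->|n_neq8] := eqVneq n 8; first by eexists; apply: skew_latin_8.
have def_n : n = n./2.*2 by rewrite even_halfK.
have [|||M skewM] := IHn n./2; try lia.
exists (double_array n./2 M).
by have := skew_latin_double _ skewM; rewrite -def_n; apply; lia.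
Qed.

(** * Arrays and incidence colorings *)

(** The last clause is condition (c) for [d = 1]: column [u] holds the colors of the weak incidences
    of [u], and a color absent from row [u] may repeat there. *)
Definition defective_array n k (M : 'I_n -> 'I_n -> nat) :=
  [/\ forall u v, u != v -> M u v < k,
      forall u v w, u != v -> u != w -> M u v = M u w -> v = w,
      forall u v, u != v -> M u v != M v u
    & forall u v w w', u != v -> u != w -> u != w' ->
        M w u = M u v -> M w' u = M u v -> w = w'].

Lemma skew_latin_defective n M :
  skew_latin n M -> @defective_array n n.-1 (fun u v => M u v).
Proof.
case=> ltM rowM colM skewM; split.
- by move=> u v neq_uv; apply: ltM.
- by move=> u v w neq_uv neq_uw /rowM eq_vw; apply/val_inj/eq_vw.
- by move=> u v neq_uv; apply: skewM.
- move=> u v w w' _ neq_uw neq_uw' <- /esym /colM eq_ww'.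
  exact/val_inj/eq_ww'.
Qed.

(** All weak incidences of [u] get the color [u], which row [u] avoids off the diagonal. *)
Lemma head_defective n : @defective_array n n (fun _ v => v).
Proof.
split=> [u v _|u v w _ _ /val_inj|u v neq_uv|u v w w' neq_uv _ _] //.
- by rewrite eq_sym.
- by move/val_inj=> eq_uv; rewrite eq_uv eqxx in neq_uv.
Qed.

(** The default value is never reached, since an edge has two distinct ends. *)
Definition other_end (G : sgraph) (i : incidence G) : G :=
  odflt (val i).1 [pick v in (val i).2 :\ (val i).1].

Lemma other_end_sinc (G : sgraph) (u : G) (v : nbr u) :
  other_end (sinc v) = val v.
Proof.
have neq_vu : val v != u.
  by apply: contraTneq (valP v) => /= ->; rewrite adj_irr.
rewrite /other_end /=; case: pickP => [w|/(_ (val v))].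
  by rewrite !inE; case: eqVneq => //= _ /eqP.
by rewrite !inE neq_vu eqxx orbT.
Qed.

Lemma other_end_winc (G : sgraph) (u : G) (v : nbr u) :
  other_end (winc v) = u.
Proof.
have neq_uv : u != val v.
  by apply: contraTneq (valP v) => /= <-; rewrite adj_irr.
rewrite /other_end /=; case: pickP => [w|/(_ u)].
  by rewrite !inE => /andP[/negPf->]; rewrite orbF => /eqP.
by rewrite !inE neq_uv eqxx.
Qed.

(** The form [k.+1] makes the color type inhabited, as [inord] requires; the coloring of [K_1] with
    no color is built apart. *)
Lemma defective_array_colorable n k M : @defective_array n k.+1 M ->
  defective_incidence_colorable (complete_graph n) 1 k.+1.
Proof.
case=> ltM rowM skewM defM; apply/existsP.
exists [ffun i : incidence (complete_graph n) =>
          inord (M (val i).1 (other_end i))].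
have sincE (u : complete_graph n) (v : nbr u) :
    inord (M (val (sinc v)).1 (other_end (sinc v))) =
    inord (M u (val v)) :> 'I_k.+1 by rewrite other_end_sinc.
have wincE (u : complete_graph n) (v : nbr u) :
    inord (M (val (winc v)).1 (other_end (winc v))) =
    inord (M (val v) u) :> 'I_k.+1 by rewrite other_end_winc.
have inord_inj u v u' v' : u != v -> u' != v' ->
    inord (M u v) = inord (M u' v') :> 'I_k.+1 -> M u v = M u' v'.
  by move=> ? ? /(congr1 val); rewrite /= !inordK ?ltM.
have neq_nbr (u : complete_graph n) (v : nbr u) : u != val v :> 'I_n.
  exact: (valP v).
have neq_nbr' (u : complete_graph n) (v : nbr u) : val v != u :> 'I_n.
  by rewrite eq_sym.
apply/forallP=> u; apply/and3P; split.
- apply/forallP=> v; apply/forallP=> w; apply/implyP; apply: contraNneq.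
  rewrite !ffunE !sincE => /inord_inj eqM.
  by apply/eqP/val_inj/(rowM u); rewrite // eqM.
- apply/forallP=> v; rewrite !ffunE sincE wincE; apply/eqP=> /inord_inj eqM.
  by have /eqP[] := skewM _ _ (neq_nbr u v); apply: eqM.
apply/forall_inP=> c /imsetP[_ /imsetP[v _ ->] ->].
apply/card_le1_eqP=> i j.
rewrite !inE => /andP[/imsetP[w _ ->]] /eqP + /andP[/imsetP[w' _ ->]] /eqP.
rewrite !ffunE sincE !wincE => /inord_inj eqw /inord_inj eqw'.
by congr winc; apply/val_inj/(defM u (val v)); rewrite ?eqw ?eqw'.
Qed.

Definition nbr_complete n (u v : 'I_n) (neq_uv : u != v) :
  @nbr (complete_graph n) u := exist _ v neq_uv.

(** On the diagonal the pair is not an incidence, so [insub] fails and the entry is 0. *)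
Definition coloring_array n k
    (phi : {ffun incidence (complete_graph n) -> 'I_k}) (u v : 'I_n) : nat :=
  if insub (u, [set u; v]) is Some i then phi i else 0.

Lemma coloring_array_sinc n k phi (u v : 'I_n) (neq_uv : u != v) :
  @coloring_array n k phi u v = phi (sinc (nbr_complete neq_uv)).
Proof.
rewrite /coloring_array; set i := sinc _.
have -> : (u, [set u; v]) = val i by [].
by rewrite valK.
Qed.

Lemma coloring_array_winc n k phi (u v : 'I_n) (neq_uv : u != v) :
  @coloring_array n k phi v u = phi (winc (nbr_complete neq_uv)).
Proof.
rewrite /coloring_array; set i := winc _.
have -> : (v, [set v; u]) = val i by rewrite setUC.
by rewrite valK.
Qed.

Lemma coloring_array_defective n k phi :
  defective_incidence_coloring 1 phi ->
  @defective_array n k (@coloring_array n k phi).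
Proof.
move=> /forallP col; split.
- by move=> u v neq_uv; rewrite coloring_array_sinc.
- move=> u v w neq_uv neq_uw; rewrite !coloring_array_sinc => /val_inj eq_phi.
  have /and3P[/forallP/(_ (nbr_complete neq_uv))/forallP] := col u.
  move=> /(_ (nbr_complete neq_uw)) + _ _.
  by rewrite eq_phi eqxx implybF negbK => /eqP/(congr1 val).
- move=> u v neq_uv;
  rewrite (coloring_array_sinc _ neq_uv) (coloring_array_winc _ neq_uv).
  by have /and3P[_ /forallP/(_ (nbr_complete neq_uv))] := col u.
move=> u v w w' neq_uv neq_uw neq_uw'.
rewrite (coloring_array_sinc _ neq_uv) (coloring_array_winc _ neq_uw).
rewrite (coloring_array_winc _ neq_uw') => /val_inj eqw /val_inj eqw'.
have /and3P[_ _ /forall_inP/(_ (phi (sinc (nbr_complete neq_uv))))] := col u.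
have strong : phi (sinc (nbr_complete neq_uv)) \in
    phi @: strong_inc (u : complete_graph n).
  by rewrite !imset_f.
move=> /(_ strong)/card_le1_eqP.
move=> /(_ (winc (nbr_complete neq_uw)) (winc (nbr_complete neq_uw'))).
by rewrite !inE eqw eqw' eqxx !imset_f // => /(_ isT isT) /(congr1 val) [].
Qed.

(** * Lower bounds *)

Lemma degree_leq_colors (G : sgraph) d k (u : G) :
  defective_incidence_colorable G d k -> #|{: nbr u}| <= k.
Proof.
case/existsP=> phi /forallP/(_ u)/and3P[/forallP row _ _].
rewrite -[k in _ <= k]card_ord.
apply: (@leq_card _ _ (fun v : nbr u => phi (sinc v))) => v w eq_phi.
apply/eqP; have /forallP/(_ w) := row v.
by rewrite eq_phi eqxx implybF negbK.
Qed.

Lemma complete_colors_geq n k :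
  defective_incidence_colorable (complete_graph n) 1 k -> n.-1 <= k.
Proof.
case: n => // n /(degree_leq_colors (ord0 : complete_graph n.+1)).
rewrite card_sig (eq_card (B := predC1 (ord0 : 'I_n.+1))); last first.
  by move=> v; rewrite !inE eq_sym.
by rewrite cardC1 card_ord.
Qed.

Lemma complete2_not_1colorable :
  ~~ defective_incidence_colorable (complete_graph 2) 1 1.
Proof.
apply/existsP=> -[phi /coloring_array_defective[ltM _ skewM _]].
pose u0 := @Ordinal 2 0 isT; pose u1 := @Ordinal 2 1 isT.
by have := skewM u0 u1 isT; have := ltM u0 u1 isT; have := ltM u1 u0 isT; lia.
Qed.

Definition perms3 :=
  [:: (0, 1, 2); (0, 2, 1); (1, 0, 2); (1, 2, 0); (2, 0, 1); (2, 1, 0)].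

Lemma mem_perms3 a b c : a < 3 -> b < 3 -> c < 3 -> a <> b -> a <> c -> b <> c ->
  (a, b, c) \in perms3.
Proof. by case: a b c => [|[|[|]]] // [|[|[|]]] // [|[|[|]]]. Qed.

Lemma complete4_not_3colorable :
  ~~ defective_incidence_colorable (complete_graph 4) 1 3.
Proof.
apply/existsP=> -[phi /coloring_array_defective].
move: (coloring_array phi) => M [ltM rowM skewM defM].
pose u0 := @Ordinal 4 0 isT; pose u1 := @Ordinal 4 1 isT.
pose u2 := @Ordinal 4 2 isT; pose u3 := @Ordinal 4 3 isT.
have row_perm u v w x : u != v -> u != w -> u != x -> v != w -> v != x ->
    w != x -> (M u v, M u w, M u x) \in perms3.
  move=> uv uw ux vw vx wx.
  apply: mem_perms3; rewrite ?ltM // => /rowM eq_rowM.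
  - by rewrite eq_rowM ?eqxx in vw.
  - by rewrite eq_rowM ?eqxx in vx.
  - by rewrite eq_rowM ?eqxx in wx.
(* Row [u] contains all three colors, so a color repeated in column [u] would occur in row [u],
   against [defM]. *)
have col_neq u v w x : u != v -> u != w -> u != x -> v != w -> v != x ->
    w != x -> M v u != M w u.
  move=> uv uw ux vw vx wx; apply/eqP=> eqM.
  have := row_perm _ _ _ _ uv uw ux vw vx wx.
  have : M v u < 3 by rewrite ltM // eq_sym.
  have neq_vw y : u != y -> M v u <> M u y.
    move=> uy eq_y; have eq_vw : v = w by apply: (defM u y) => //; rewrite -eqM.
    by rewrite eq_vw eqxx in vw.
  have := neq_vw _ uv; have := neq_vw _ uw; have := neq_vw _ ux.
  rewrite !inE !xpair_eqE; lia.
(* Each row is one of six permutations, which leaves [6^4] arrays. The conjunction lists the six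
   transposed pairs, then the three pairs of entries in each of the four columns. *)
have exhaust : all (fun r0 => all (fun r1 => all (fun r2 => all (fun r3 =>
    let: (a01, a02, a03) := r0 in let: (a10, a12, a13) := r1 in
    let: (a20, a21, a23) := r2 in let: (a30, a31, a32) := r3 in
    ~~ [&& a01 != a10, a02 != a20, a03 != a30, a12 != a21, a13 != a31,
           a23 != a32, a10 != a20, a10 != a30, a20 != a30,
           a01 != a21, a01 != a31, a21 != a31,
           a02 != a12, a02 != a32, a12 != a32,
           a03 != a13, a03 != a23 & a13 != a23])
  perms3) perms3) perms3) perms3 by vm_compute.
move/allP: exhaust => /(_ _ (row_perm u0 u1 u2 u3 isT isT isT isT isT isT)).
move/allP => /(_ _ (row_perm u1 u0 u2 u3 isT isT isT isT isT isT)).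
move/allP => /(_ _ (row_perm u2 u0 u1 u3 isT isT isT isT isT isT)).
move/allP => /(_ _ (row_perm u3 u0 u1 u2 isT isT isT isT isT isT)).
rewrite !skewM // (col_neq u0 u1 u2 u3) // (col_neq u0 u1 u3 u2) //.
rewrite (col_neq u0 u2 u3 u1) // (col_neq u1 u0 u2 u3) //.
rewrite (col_neq u1 u0 u3 u2) // (col_neq u1 u2 u3 u0) //.
rewrite (col_neq u2 u0 u1 u3) // (col_neq u2 u0 u3 u1) //.
rewrite (col_neq u2 u1 u3 u0) // (col_neq u3 u0 u1 u2) //.
by rewrite (col_neq u3 u0 u2 u1) // (col_neq u3 u1 u2 u0).
Qed.

(** * Upper bounds and conclusion *)

Lemma complete1_0colorable :
  defective_incidence_colorable (complete_graph 1) 1 0.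
Proof.
(* Without incidences the empty map is a coloring, even into the empty type ['I_0]. *)
have no_inc : #|{: incidence (complete_graph 1)}| = 0.
  apply: eq_card0 => -[[u E] inc_uE]; exfalso; move: inc_uE.
  rewrite /is_incidence /= inE => /andP[_ /existsP[x /existsP[y]]].
  by rewrite /= (ord1 x) (ord1 y) eqxx.
apply/existsP; exists (ffun0 no_inc).
have no_nbr (u : complete_graph 1) (v : nbr u) : False.
  by case: v => v /=; rewrite (ord1 u) (ord1 v) eqxx.
apply/forallP=> u; apply/and3P; split.
- by apply/forallP=> v; case: (no_nbr u v).
- by apply/forallP=> v; case: (no_nbr u v).
by apply/forall_inP=> -[].
Qed.

Lemma complete_colorable_pred n : 0 < n -> n != 2 -> n != 4 ->
  defective_incidence_colorable (complete_graph n) 1 n.-1.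
Proof.
case: n => [//|[_ _ _|[//|n _ _ n_neq4]]]; first exact: complete1_0colorable.
have [M skewM] := skew_latin_exists (isT : 2 < n.+3) n_neq4.
exact: defective_array_colorable (skew_latin_defective skewM).
Qed.

Lemma complete_colorable n : 0 < n ->
  defective_incidence_colorable (complete_graph n) 1 n.
Proof.
by case: n => // n _; apply: defective_array_colorable (head_defective _).
Qed.

Theorem theorem4 (n : nat) (n_gt0 : 0 < n) :
  (n <> 2 /\ n <> 4 ->
     defective_incidence_chromatic (complete_graph n) 1 = n - 1) /\
  (n = 2 \/ n = 4 ->
     defective_incidence_chromatic (complete_graph n) 1 = n).
Proof.
rewrite /defective_incidence_chromatic; case: ex_minnP => k col_k min_k.
have := complete_colors_geq col_k; split=> [[/eqP n_neq2 /eqP n_neq4]|n24].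
  by have := min_k _ (complete_colorable_pred n_gt0 n_neq2 n_neq4); lia.
(* The minimum lies between [n.-1] and [n], so it suffices to exclude [n.-1]. *)
have k_neq : k != n.-1.
  apply/eqP=> def_k; move: col_k; rewrite def_k; case: n24 => ->; apply/negP.
    exact: complete2_not_1colorable.
  exact: complete4_not_3colorable.
by have := min_k _ (complete_colorable n_gt0); lia.
Qed.
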